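(* For $i=1,2,3,4$, the tangent cone $TC_{P_i}W_{KLM}^9$ to $W_{KLM}^9\subset\mathbb{P}^9$ at the point $P_i$ is a cone over a Veronese surface.
   Context: We work over $\mathbb{C}$. Let $W_F^{13}\subset\mathbb{P}^{13}_{[w_0:\dots:w_{13}]}$ be the closure of the image of the rational map on $\mathbb{P}^3_{[t_0:\dots:t_3]}$ defined by the sextic surfaces having double points along the six edges of the tetrahedron $\{t_0t_1t_2t_3=0\}$, i.e. given by $w_0=t_0t_1^3t_2t_3$, $w_1=t_0^2t_1^2t_2^2$, $w_2=t_0^2t_1^2t_2t_3$, $w_3=t_0^2t_1^2t_3^2$, $w_4=t_0^3t_1t_2t_3$, $w_5=t_0t_1^2t_2^2t_3$, $w_6=t_0t_1^2t_2t_3^2$, $w_7=t_0^2t_1t_2^2t_3$, $w_8=t_0^2t_1t_2t_3^2$, $w_9=t_1^2t_2^2t_3^2$, $w_{10}=t_0t_1t_2^3t_3$, $w_{11}=t_0t_1t_2^2t_3^2$, $w_{12}=t_0t_1t_2t_3^3$, $w_{13}=t_0^2t_2^2t_3^2$. It has eight quadruple points, namely the coordinate points with only nonzero coordinate $w_k$, $k\in\{0,1,3,4,9,10,12,13\}$. Fix a general hyperplane $H_{12}=\{\sum_{i=0}^{13}a_iw_i=0\}$ with $a_0=1$ and $a_1,a_3,a_4,a_9,a_{10},a_{12},a_{13}\ne0$. Let $E_3$ be the elliptic quartic curve cut out on $W_F^{13}$ by $w_0+a_1w_1+a_2w_2+a_3w_3+a_4w_4=w_5=\dots=w_{13}=0$.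 The KLM-EF 3-fold $W_{KLM}^9\subset\mathbb{P}^9_{[z_0:\dots:z_9]}$ is the (closure of the) image of $W_F^{13}$ under the projection from $\langle E_3\rangle\cong\mathbb{P}^3$, given by $[w_0:\dots:w_{13}]\mapsto[w_0+a_1w_1+a_2w_2+a_3w_3+a_4w_4:w_5:w_6:w_7:w_8:w_9:w_{10}:w_{11}:w_{12}:w_{13}]$. The points $P_1,P_2,P_3,P_4\in W_{KLM}^9$ are the coordinate points of $\mathbb{P}^9$ with only nonzero coordinate $z_5$, $z_9$, $z_6$, $z_8$ respectively; they are the images of the quadruple points of $W_F^{13}$ with only nonzero coordinate $w_9$, $w_{13}$, $w_{10}$, $w_{12}$ respectively. *)

(* Defs.v *)
From mathcomp Require Import all_boot all_order all_algebra.
From mathcomp Require Import complex.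
From mathcomp Require Import reals.
From mathcomp Require Import mpoly.

Set Implicit Arguments.
Unset Strict Implicit.
Unset Printing Implicit Defensive.

Import GRing.Theory.
Local Open Scope ring_scope.

(* A point of P^(n-1) is represented by any of its nonzero coordinate vectors
   in 'rV[C]_n, and a subset of P^(n-1) by a predicate on such vectors (not
   necessarily closed under scaling). *)

(* The homogeneous ideal of S: every homogeneous component vanishes on S. *)
Definition proj_ideal (C : fieldType) (n : nat) (S : 'rV[C]_n -> Prop)
    (f : {mpoly C[n]}) : Prop :=
  forall (d : nat) (v : 'rV[C]_n), S v -> (pihomog mdeg d f).@[v 0] = 0.

Definition proj_closure (C : fieldType) (n : nat) (S : 'rV[C]_n -> Prop)
    (v : 'rV[C]_n) : Prop :=
  v != 0 /\
  forall (d : nat) (f : {mpoly C[n]}),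
    f \is d.-homog -> proj_ideal S f -> f.@[v 0] = 0.

(* The image of X under the rational map phi; phi is undefined where it
   takes the value 0. *)
Definition rat_image (C : fieldType) (m n : nat) (phi : 'rV[C]_m -> 'rV[C]_n)
    (X : 'rV[C]_m -> Prop) (w : 'rV[C]_n) : Prop :=
  w != 0 /\ exists2 t : 'rV[C]_m, X t & w = phi t.

Definition ideal_span (A : comNzRingType) (G : A -> Prop) (f : A) : Prop :=
  exists s : seq (A * A),
    (forall c, c \in s -> G c.2) /\ f = \sum_(c <- s) c.1 * c.2.

(* The equation f read in the affine chart z_k != 0 around p (p 0 k != 0):
   'X_j stands for z_j / z_k - p_j / p_k when j != k, and 'X_k does not occur. *)
Definition chart_at (C : fieldType) (n : nat) (p : 'rV[C]_n) (k : 'I_n)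
    (f : {mpoly C[n]}) : {mpoly C[n]} :=
  f \mPo [tuple if j == k then 1 else 'X_j + (p 0 j / p 0 k)%:MP | j < n].

Definition is_initial_form (C : fieldType) (n : nat) (g h : {mpoly C[n]}) : Prop :=
  exists d : nat,
    [/\ h = pihomog mdeg d g, h != 0
      & forall e : nat, (e < d)%N -> pihomog mdeg e g = 0].

(* The homogeneous ideal of the (embedded, projective) tangent cone at p of the
   closed set with homogeneous ideal proj_ideal S, as a closed subscheme of
   P^(n-1).  It is generated by the initial forms at p of the equations of S in
   an affine chart; the substitution of z_j - (p_j / p_k) z_k for 'X_j takes the
   projective closure.  All charts around p give the same ideal. *)
Definition tangent_cone_ideal (C : fieldType) (n : nat) (S : 'rV[C]_n -> Prop)
    (p : 'rV[C]_n) : {mpoly C[n]} -> Prop :=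
  ideal_span (fun g : {mpoly C[n]} =>
    exists (k : 'I_n) (f h : {mpoly C[n]}),
      [/\ p 0 k != 0, proj_ideal S f, is_initial_form (chart_at p k f) h
        & g = h \mPo [tuple 'X_j - (p 0 j / p 0 k) *: 'X_k | j < n]]).

Definition veronese_map (C : fieldType) (x : 'rV[C]_3) : 'rV[C]_6 :=
  \row_(i < 6) [:: x 0 0 ^+ 2; x 0 0 * x 0 1; x 0 0 * x 0 2;
                   x 0 1 ^+ 2; x 0 1 * x 0 2; x 0 2 ^+ 2]`_i.

(* The Veronese surface in the 5-plane spanned by the rows of M (row_free M). *)
Definition veronese_surface (C : fieldType) (n : nat) (M : 'M[C]_(6, n))
    (v : 'rV[C]_n) : Prop :=
  exists (c : C) (x : 'rV[C]_3),
    [/\ c != 0, x != 0 & v = c *: (veronese_map x *m M)].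

(* The union of the lines joining p to the points of V. *)
Definition cone_over (C : fieldType) (n : nat) (p : 'rV[C]_n)
    (V : 'rV[C]_n -> Prop) (v : 'rV[C]_n) : Prop :=
  v != 0 /\ exists (b c : C) (q : 'rV[C]_n), V q /\ v = b *: p + c *: q.

(* The closed subscheme of P^(n-1) with homogeneous ideal I is the cone with
   vertex p over a Veronese surface whose span does not contain p. *)
Definition is_cone_over_veronese (C : fieldType) (n : nat) (p : 'rV[C]_n)
    (I : {mpoly C[n]} -> Prop) : Prop :=
  exists M : 'M[C]_(6, n),
    [/\ row_free M, ~~ (p <= M)%MS
      & forall f, I f <-> proj_ideal (cone_over p (veronese_surface M)) f].

Definition sextic_map (C : fieldType) (t : 'rV[C]_4) : 'rV[C]_14 :=
  let t0 := t 0 0 in let t1 := t 0 1 in let t2 := t 0 2 in let t3 := t 0 3 in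
  \row_(i < 14) [:: t0 * t1 ^+ 3 * t2 * t3;
                    t0 ^+ 2 * t1 ^+ 2 * t2 ^+ 2;
                    t0 ^+ 2 * t1 ^+ 2 * t2 * t3;
                    t0 ^+ 2 * t1 ^+ 2 * t3 ^+ 2;
                    t0 ^+ 3 * t1 * t2 * t3;
                    t0 * t1 ^+ 2 * t2 ^+ 2 * t3;
                    t0 * t1 ^+ 2 * t2 * t3 ^+ 2;
                    t0 ^+ 2 * t1 * t2 ^+ 2 * t3;
                    t0 ^+ 2 * t1 * t2 * t3 ^+ 2;
                    t1 ^+ 2 * t2 ^+ 2 * t3 ^+ 2;
                    t0 * t1 * t2 ^+ 3 * t3;
                    t0 * t1 * t2 ^+ 2 * t3 ^+ 2;
                    t0 * t1 * t2 * t3 ^+ 3;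
                    t0 ^+ 2 * t2 ^+ 2 * t3 ^+ 2]`_i.

Definition W_F13 (C : fieldType) : 'rV[C]_14 -> Prop :=
  proj_closure (rat_image (@sextic_map C) (fun t => t != 0)).

Definition KLM_projection (C : fieldType) (a : 'I_14 -> C) (w : 'rV[C]_14) :
    'rV[C]_10 :=
  \row_(i < 10) [:: w 0 0 + a 1 * w 0 1 + a 2 * w 0 2 + a 3 * w 0 3 + a 4 * w 0 4;
                    w 0 5; w 0 6; w 0 7; w 0 8; w 0 9;
                    w 0 10; w 0 11; w 0 12; w 0 13]`_i.

Definition W_KLM9 (C : fieldType) (a : 'I_14 -> C) : 'rV[C]_10 -> Prop :=
  proj_closure (rat_image (KLM_projection a) (@W_F13 C)).

Definition P_KLM (C : fieldType) (i : 'I_4) : 'rV[C]_10 :=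
  delta_mx 0 (tnth [tuple 5; 9; 6; 8] i).

(* Main.v *)
Require Import Defs.
From mathcomp Require Import all_boot all_order all_algebra.
From mathcomp Require Import complex.
From mathcomp Require Import reals.
From mathcomp Require Import mpoly.
From mathcomp Require Import ring.

(** Near each of the four points the threefold has a parametrization by even
    polynomials.  For the first point, put t = (pqr, r, p, q): the sextics become
    (pqr)^2 times 1, p^2, pq, pr, q^2, qr, p^2 q r, p q^2 r, p^2 q^2 and, for the
    coordinate z_0 combining w_0, ..., w_4,
      r^2 + a_1 p^2 r^2 + a_2 p q r^2 + a_3 q^2 r^2 + a_4 p^2 q^2 r^2.
    So the germ looks like the cone over the Veronese surface, the quotient of
    3-space by (p, q, r) |-> (-p, -q, -r): six of the nine affine coordinates start
    with the six quadratic monomials, the other three have order 4.  The other points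
    have the same form after a permutation of the coordinates and of the a_k, r^2
    being then multiplied by a_4, a_1 or a_3; this is where these have to be nonzero.
    The tables [point_coords], [point_coefs] and [point_param] record the four cases.

    It remains to compute the tangent cone of any threefold with such a local model
    (theorem [tangent_cone_veronese]).  One inclusion of ideals is a limit: an
    equation vanishing on the local model has an initial form that vanishes on the
    quadratic parts, hence on the cone ([tangent_cone_vanish]).  For the other one,
    nine explicit equations have as initial forms the three remaining coordinates and
    the six quadrics of the Veronese surface ([tangent_cone_equation]).  These
    generate the ideal of the cone: modulo them every polynomial has a normal form
      B_0 + pq B_1 + pr B_2 + qr B_3
    with the B_i polynomials in the vertex coordinate and p^2, q^2, r^2
    ([normal_all]), and sign changes of p, q, r show that a normal form vanishing on
    the cone is 0 ([nform_eq0]). *)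

Set Implicit Arguments.
Unset Strict Implicit.
Unset Printing Implicit Defensive.

Import GRing.Theory Num.Theory.
Local Open Scope ring_scope.

(** * Polynomials over an algebraically closed field *)

(** [P * s] vanishes everywhere, and a nonzero polynomial over a closed field
    has a non-root.  The factor [s] is how finitely many bad values of a
    parameter get discarded below. *)
Lemma poly_eq0_generic (C : closedFieldType) (P s : {poly C}) :
  s != 0 -> (forall l, s.[l] != 0 -> P.[l] = 0) -> P = 0.
Proof.
move=> s0 Ps; apply/eqP; apply: contraT => P0.
have /closed_nonrootP [x] : P * s != 0 by rewrite mulf_neq0.
by rewrite rootM negb_or => /andP[/negP Px sx]; case: Px; apply/rootP/Ps.
Qed.

(** The left inverse of [muni] is used through its additivity and its values on
    monomials only. *)
Lemma muni_inj0 n (R : comNzRingType) (p : {mpoly R[n.+1]}) : muni p = 0 -> p = 0.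
Proof.
pose g q := (map_poly (@mwiden n R) (muni q)).['X_ord_max].
have gD q r : g (q + r) = g q + g r by rewrite /g muniD rmorphD hornerD.
have gX c m : g (c *: 'X_[m]) = c *: 'X_[m].
  rewrite /g muniE.
  have [->|c0] := eqVneq c 0; first by rewrite scale0r msupp0 big_nil rmorph0 horner0.
  rewrite msuppMCX // big_seq1 mcoeffZ mcoeffX eqxx mulr1.
  rewrite -mul_polyC rmorphM /= map_polyC /= map_polyXn hornerM hornerC hornerXn.
  rewrite mwidenZ mwidenX -scalerAl; congr (_ *: _).
  rewrite mpolyXn -mpolyXD; congr 'X_[_]; apply/mnmP => i.
  rewrite mnmDE mulmnE mnm1E.
  case: (unliftP ord_max i) => [j|] ->; last by rewrite mnmwiden_ordmax eqxx mul1n.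
  have -> : lift ord_max j = widen_ord (leqnSn n) j.
    by apply: val_inj; rewrite /= /bump leqNgt ltn_ord.
  rewrite mnmwiden_widen mnmE -val_eqE /= eq_sym (ltn_eqF (ltn_ord j)) mul0n addn0.
  by congr (m _); apply: val_inj.
have gE : forall q, g q = q.
  have g0 : g 0 = 0 by rewrite /g muni0 rmorph0 horner0.
  move: g gD gX g0 => g gD gX g0.
  by elim/mpolyind => // c m q _ _ IH; rewrite gD gX IH.
by move=> p0; rewrite -(gE p) /g p0 rmorph0 horner0.
Qed.

(** Induction on the number of variables: with the first ones fixed, [p] is a
    univariate polynomial with infinitely many roots, so each of its coefficients
    vanishes at every point. *)
Lemma mpoly_eq0_meval (C : closedFieldType) n (p : {mpoly C[n]}) :
  (forall v, p.@[v] = 0) -> p = 0.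
Proof.
elim: n p => [|n IH] p pv.
  by rewrite (nvar0_mpolyC p); move: (pv (fun=> 0)); rewrite {1}(nvar0_mpolyC p) mevalC => ->.
apply: muni_inj0; apply/polyP => j; rewrite coef0.
apply: IH => v.
suff: map_poly (meval v) (muni p) = 0.
  by move/polyP/(_ j); rewrite coef_map coef0.
apply: (@poly_eq0_generic _ _ 1) => [|l _]; first exact: oner_neq0.
rewrite -[RHS](pv (fun i => if unlift ord_max i is Some k then v k else l)).
rewrite muniE [in RHS](mpolyE p) !raddf_sum /= horner_sum; apply: eq_bigr => m _.
rewrite -mul_polyC rmorphM /= map_polyC /= map_polyXn hornerM hornerC hornerXn.
rewrite !mevalZ !mevalX -mulrA; congr (_ * _).
rewrite big_ord_recr /= unlift_none; congr (_ * _).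
apply: eq_bigr => i _; rewrite mnmE.
have E : widen_ord (leqnSn n) i = lift ord_max i.
  by apply: val_inj; rewrite /= /bump leqNgt ltn_ord.
rewrite E liftK -E; congr (_ ^+ m _); exact: val_inj.
Qed.

(** * Ideals and homogeneous components *)

Lemma ideal_span0 (A : comNzRingType) (G : A -> Prop) : ideal_span G 0.
Proof. by exists [::]; split=> //; rewrite big_nil. Qed.

Lemma ideal_span_gen (A : comNzRingType) (G : A -> Prop) g : G g -> ideal_span G g.
Proof.
move=> Gg; exists [:: (1, g)]; split; last by rewrite big_seq1 mul1r.
by move=> c; rewrite inE => /eqP ->.
Qed.

Lemma ideal_spanD (A : comNzRingType) (G : A -> Prop) f g :
  ideal_span G f -> ideal_span G g -> ideal_span G (f + g).
Proof.
move=> [s [Gs ->]] [t [Gt ->]]; exists (s ++ t); split; last by rewrite big_cat.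
by move=> c; rewrite mem_cat => /orP[/Gs|/Gt].
Qed.

Lemma ideal_spanMl (A : comNzRingType) (G : A -> Prop) f g :
  ideal_span G g -> ideal_span G (f * g).
Proof.
move=> [s [Gs ->]]; exists [seq (f * c.1, c.2) | c <- s]; split.
  by move=> c /mapP[c' /Gs Gc ->].
by rewrite big_map mulr_sumr; apply: eq_bigr => c _; rewrite mulrA.
Qed.

Lemma dhomog_mevalZ (R : comNzRingType) n d (p : {mpoly R[n]}) l v :
  p \is d.-homog -> p.@[fun i => l * v i] = l ^+ d * p.@[v].
Proof.
move=> /dhomogP hp; rewrite !mevalE mulr_sumr; apply: eq_big_seq => m /hp <-.
under eq_bigr do rewrite exprMn.
by rewrite big_split /= prodrXr mdegE mulrCA.
Qed.

Lemma meval_pihomog (R : comNzRingType) n (p : {mpoly R[n]}) v k :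
  (msize p <= k)%N -> p.@[v] = \sum_(d < k) (pihomog mdeg d p).@[v].
Proof. by move=> pk; rewrite {1}(@pihomog_partitionE _ _ mdeg k p) // raddf_sum. Qed.

Lemma pihomog_homog (R : comNzRingType) n d e (p : {mpoly R[n]}) :
  p \is d.-homog -> pihomog mdeg e p = if d == e then p else 0.
Proof.
by move=> hp; case: eqVneq => [<-|de]; [exact: pihomog_dE | exact: pihomog_ne0 de hp].
Qed.

Lemma dhomog_comp (R : comNzRingType) n k d (p : {mpoly R[n]})
    (L : n.-tuple {mpoly R[k]}) :
  p \is d.-homog -> (forall i, tnth L i \is 1.-homog) -> p \mPo L \is d.-homog.
Proof.
move=> /dhomogP hp hL; rewrite comp_mpolyE big_seq rpred_sum // => m /hp md.
apply: rpredZ; have <- : (\sum_i m i)%N = d by rewrite -mdegE -md.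
elim/big_ind2: _ => [|p1 d1 p2 d2|i _]; [exact: dhomog1 | exact: dhomogM |].
by have := dhomogMn (m i) (hL i); rewrite mul1n.
Qed.

Lemma proj_ideal_homog (C : fieldType) n (S : 'rV[C]_n -> Prop) d f :
  f \is d.-homog -> (forall v, S v -> f.@[v 0] = 0) -> proj_ideal S f.
Proof.
move=> hf Sf e v Sv; rewrite (pihomog_homog e hf).
by case: ifP; rewrite ?raddf0 // => _; apply: Sf.
Qed.

(** The closure is defined by homogeneous equations, and the components of an
    equation of [S] are themselves homogeneous equations of [S]. *)
Lemma proj_ideal_closure (C : fieldType) n (S : 'rV[C]_n -> Prop) f :
  (forall v, S v -> v != 0) -> proj_ideal (proj_closure S) f <-> proj_ideal S f.
Proof.
move=> S0; split=> Sf d v Sv.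
  by apply: Sf; split=> [|e g hg Sg]; [exact: S0 | rewrite -(pihomog_dE hg); exact: Sg].
have [_] := Sv; apply=> [|e w Sw]; first exact: pihomogP.
by rewrite (pihomog_homog _ (pihomogP _ _ _)); case: ifP; rewrite ?raddf0 // => _; apply: Sf.
Qed.

(** On the line through [v], [f] is the polynomial in the scale factor whose
    coefficients are the values at [v] of the components of [f]. *)
Lemma proj_ideal_scaling (C : closedFieldType) n (S : 'rV[C]_n -> Prop) f :
  (forall l v, l != 0 -> S v -> S (l *: v)) ->
  proj_ideal S f <-> forall v, S v -> f.@[v 0] = 0.
Proof.
move=> Sl; split=> Sf.
  by move=> v Sv; rewrite (meval_pihomog _ (leqnn _)) big1 // => d _; apply: Sf.
move=> d v Sv; pose k := maxn (msize f) d.+1.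
pose P := \poly_(e < k) (pihomog mdeg e f).@[v 0].
have P0 : P = 0.
  apply: (@poly_eq0_generic _ _ 'X); first by rewrite polyX_eq0.
  move=> l; rewrite hornerX => l0; rewrite -[RHS](Sf _ (Sl l v l0 Sv)).
  rewrite horner_poly (meval_pihomog _ (leq_maxl _ d.+1)); apply: eq_bigr => e _.
  rewrite (meval_eq (v1 := (l *: v) 0) (v2 := fun i => l * v 0 i)) => [|i]; last by rewrite mxE.
  by rewrite (dhomog_mevalZ _ _ (pihomogP _ _ _)) mulrC.
have := congr1 (fun Q : {poly C} => Q`_d) P0.
by rewrite coef_poly coef0 leq_max ltnSn orbT.
Qed.

(** Along the curve [l |-> l ^+ e * y l] the component of degree [j] of [g]
    contributes [l ^+ (e * j)] times its value at [y l].  Dividing by the lowest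
    power [l ^+ (e * d)] and letting [l] go to 0 leaves the initial form at [y 0].
    The limit is taken algebraically: the quotient is a polynomial in [l] that
    vanishes off the zeros of [s], hence everywhere. *)
Lemma initial_form_limit (C : closedFieldType) n d e (g : {mpoly C[n]})
    (y : 'I_n -> {poly C}) (s : {poly C}) :
  (0 < e)%N -> (forall j, (j < d)%N -> pihomog mdeg j g = 0) -> s != 0 ->
  (forall l, s.[l] != 0 -> g.@[fun i => l ^+ e * (y i).[l]] = 0) ->
  (pihomog mdeg d g).@[fun i => (y i).[0]] = 0.
Proof.
move=> e0 glow s0 gs; pose k := maxn (msize g) d.+1.
pose ev (p : {mpoly C[n]}) := mmap (@polyC C) y p.
have evE p l : (ev p).[l] = p.@[fun i => (y i).[l]].
  rewrite /ev /mmap horner_sum mevalE; apply: eq_bigr => m _.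
  rewrite hornerM hornerC /mmap1 horner_prod; congr (_ * _).
  by apply: eq_bigr => i _; rewrite horner_exp.
pose P := \sum_(j < k | (d <= j)%N) 'X^(e * (j - d)) * ev (pihomog mdeg j g).
have P0 : P = 0.
  apply: (@poly_eq0_generic _ _ ('X * s)); first by rewrite mulf_neq0 ?polyX_eq0.
  move=> l; rewrite hornerM hornerX mulf_eq0 negb_or => /andP[l0 sl].
  have := gs l sl; rewrite (meval_pihomog _ (leq_maxl _ d.+1)).
  under eq_bigr => j _ do rewrite (dhomog_mevalZ _ _ (pihomogP _ _ _)) -exprM.
  rewrite (bigID (fun j : 'I_k => (d <= j)%N)) /= [X in _ + X]big1 => [|j]; last first.
    by rewrite -ltnNge => jd; rewrite glow // raddf0 mulr0.
  rewrite addr0 => H; apply: (mulfI (expf_neq0 (e * d) l0)).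
  rewrite mulr0 -[RHS]H /P horner_sum mulr_sumr; apply: eq_bigr => j dj.
  by rewrite hornerM hornerXn evE mulrA -exprD -mulnDr subnKC.
have := congr1 (fun Q : {poly C} => Q.[0]) P0; rewrite horner0 horner_sum.
have dk : (d < k)%N by rewrite leq_max ltnSn orbT.
rewrite (bigD1 (Ordinal dk)) //= hornerM hornerXn subnn muln0 expr0 mul1r evE.
rewrite big1 ?addr0 // => j /andP[dj jd]; rewrite hornerM hornerXn.
rewrite expr0n muln_eq0 subn_eq0 (gtn_eqF e0) /= leqNgt ltn_neqAle dj andbT.
by rewrite eq_sym -val_eqE /= in jd *; rewrite jd mul0r.
Qed.

(** Unlike mere vanishing on [S], this includes [l = 0], that is, the origin. *)
Lemma proj_ideal_scale (C : fieldType) n (S : 'rV[C]_n -> Prop) f l v (w : 'I_n -> C) :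
  proj_ideal S f -> S v -> (forall i, w i = l * v 0 i) -> f.@[w] = 0.
Proof.
move=> Sf Sv wE; rewrite (meval_eq (v2 := fun i => l * v 0 i)) //.
rewrite (meval_pihomog _ (leqnn _)) big1 // => d _.
by rewrite (dhomog_mevalZ _ _ (pihomogP _ _ _)) Sf ?mulr0.
Qed.

(** * The local model *)

(** The affine coordinates, in the order
    1, p^2, pq, pr, q^2, qr, (r^2), p^2 q r, p q^2 r, p^2 q^2, of the threefold
    near one of the four points.  The even polynomials in p, q, r are the
    functions on the cone over the Veronese surface; the coordinate that would be r^2
    before the projection from the span of the elliptic curve is perturbed by
    terms of order 4 and 6, which does not affect initial forms when [c 0] is
    nonzero. *)
Definition local_coords (A : comNzRingType) (c : nat -> A) (p q r : A) : seq A :=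
  [:: 1; p ^+ 2; p * q; p * r; q ^+ 2; q * r;
      c 0%N * r ^+ 2 + c 1%N * (p * r) ^+ 2 + c 2%N * (p * r) * (q * r)
        + c 3%N * (q * r) ^+ 2 + c 4%N * (p * q * r) ^+ 2;
      p ^+ 2 * q * r; p * q ^+ 2 * r; p ^+ 2 * q ^+ 2].

(** The part of order 2 of [local_coords], with the coordinate along the vertex
    now free. *)
Definition cone_coords (A : comNzRingType) (c0 b p q r : A) : seq A :=
  [:: b; p ^+ 2; p * q; p * r; q ^+ 2; q * r; c0 * r ^+ 2; 0; 0; 0].

(** Pairs [(h, e)] such that [x 0 * h + e = 0] holds on the local model, where
    neither [h] nor [e] involves [x 0] and [e] has one degree more than [h]: in the
    chart [x 0 = 1] the initial form of the equation is [h].  The last three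
    come from [c 0 * r ^+ 2 = x 6 - tail], valid in the chart, multiplied by p^2, pq
    and q^2.  The nine forms [h] are three coordinates and the six quadrics of the
    Veronese surface. *)
Definition local_equations (A : comNzRingType) (c : nat -> A) (x : 'I_10 -> A) : seq (A * A) :=
  let tail := c 1%N * (x 3 * x 3) + c 2%N * (x 3 * x 5) + c 3%N * (x 5 * x 5) + c 4%N * (x 7 * x 5) in
  [:: (x 7, - (x 3 * x 2)); (x 8, - (x 5 * x 2)); (x 9, - (x 2 * x 2));
      (x 2 * x 2 - x 1 * x 4, 0); (x 2 * x 3 - x 1 * x 5, 0); (x 2 * x 5 - x 4 * x 3, 0);
      (c 0%N * (x 3 * x 3) - x 1 * x 6, x 1 * tail);
      (c 0%N * (x 3 * x 5) - x 2 * x 6, x 2 * tail);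
      (c 0%N * (x 5 * x 5) - x 4 * x 6, x 4 * tail)].

Lemma dhomog_var (C : comNzRingType) n i : ('X_i : {mpoly C[n]}) \is 1.-homog.
Proof. by rewrite dhomogX; apply/eqP; exact: mdeg1. Qed.

Lemma dhomog_var2 (C : comNzRingType) n i j : ('X_i * 'X_j : {mpoly C[n]}) \is 2.-homog.
Proof. exact: dhomogM (dhomog_var _ i) (dhomog_var _ j). Qed.

Lemma dhomog_cvar2 (C : comNzRingType) n a i j : (a%:MP * ('X_i * 'X_j) : {mpoly C[n]}) \is 2.-homog.
Proof. by rewrite mul_mpolyC rpredZ // dhomog_var2. Qed.

Lemma local_equations_homog (C : comNzRingType) (s : 'I_10 -> 'I_10) (c : nat -> C) he :
  he \in local_equations (fun i => (c i)%:MP) (fun i => 'X_(s i)) ->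
  exists d, he.1 \is d.-homog /\ he.2 \is d.+1.-homog.
Proof.
have e_homog : (c 1%N)%:MP * ('X_(s 3) * 'X_(s 3)) + (c 2%N)%:MP * ('X_(s 3) * 'X_(s 5))
    + (c 3%N)%:MP * ('X_(s 5) * 'X_(s 5)) + (c 4%N)%:MP * ('X_(s 7) * 'X_(s 5))
    \is @ishomog1 10 C 2 mdeg.
  by do ?apply: rpredD; apply: dhomog_cvar2.
case/(nthP (0, 0)) => k k9 <-; exists (if (k < 3)%N then 1 else 2)%N.
case: k k9 => [|[|[|[|[|[|[|[|[|//]]]]]]]]] _ /=; split;
  rewrite ?dhomogN ?dhomog_var ?dhomog_var2 ?dhomog0 //;
  by [rewrite rpredB ?dhomog_var2 ?dhomog_cvar2 | exact: dhomogM (dhomog_var _ _) e_homog].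
Qed.

Lemma local_equations_meval (C : comNzRingType) (s : 'I_10 -> 'I_10) (c : nat -> C) he v :
  he \in local_equations (fun i => (c i)%:MP) (fun i => 'X_(s i)) ->
  (he.1.@[v], he.2.@[v]) \in local_equations c (fun i => v (s i)).
Proof.
case/(nthP (0, 0)) => k k9 <-; apply/(nthP (0, 0)); exists k => //.
by case: k k9 => [|[|[|[|[|[|[|[|[|//]]]]]]]]] _ /=;
  rewrite ?(mevalD, mevalB, mevalN, mevalM, mevalC, mevalXU) ?meval0.
Qed.

(** ** Normal forms modulo the quadrics *)

(** With the [b]'s taken among polynomials in the squares p^2, q^2, r^2 (and the
    vertex coordinate), this is the general even polynomial in p, q, r, sorted by
    the parities of the exponents of p, q, r. *)
Definition normal_form (A : comNzRingType) (x : 'I_10 -> A) (b0 b1 b2 b3 : A) : A :=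
  b0 + x 2 * b1 + x 3 * b2 + x 5 * b3.

Lemma normal_formZ (A : comNzRingType) (x : 'I_10 -> A) y b0 b1 b2 b3 :
  y * normal_form x b0 b1 b2 b3 = normal_form x (y * b0) (y * b1) (y * b2) (y * b3).
Proof. by rewrite /normal_form; ring. Qed.

Lemma normal_formD (A : comNzRingType) (x : 'I_10 -> A) a0 a1 a2 a3 b0 b1 b2 b3 :
  normal_form x a0 a1 a2 a3 + normal_form x b0 b1 b2 b3 =
  normal_form x (a0 + b0) (a1 + b1) (a2 + b2) (a3 + b3).
Proof. by rewrite /normal_form; ring. Qed.

(** Each of the products pq * pq, pq * pr, pq * qr is rewritten by one quadric.
    The same holds in the next two lemmas for pr and qr; there [x 6] stands for
    [c * r ^+ 2], whence the division by [c]. *)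
Lemma normal_form_pq (A : comNzRingType) (x : 'I_10 -> A) b0 b1 b2 b3 :
  x 2 * normal_form x b0 b1 b2 b3 =
  normal_form x (x 1 * x 4 * b1) b0 (x 4 * b3) (x 1 * b2) +
  (b1 * (x 2 * x 2 - x 1 * x 4) + b2 * (x 2 * x 3 - x 1 * x 5)
   + b3 * (x 2 * x 5 - x 4 * x 3)).
Proof. by rewrite /normal_form; ring. Qed.

Lemma normal_form_pr (A : comNzRingType) (x : 'I_10 -> A) c d b0 b1 b2 b3 :
  d * c = 1 ->
  x 3 * normal_form x b0 b1 b2 b3 =
  normal_form x (d * x 1 * x 6 * b2) (d * x 6 * b3) b0 (x 1 * b1) +
  (b1 * (x 2 * x 3 - x 1 * x 5) + d * b2 * (c * (x 3 * x 3) - x 1 * x 6)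
   + d * b3 * (c * (x 3 * x 5) - x 2 * x 6)).
Proof.
rewrite /normal_form => dc; apply/eqP; rewrite -subr_eq0; apply/eqP.
transitivity ((1 - d * c) * (x 3 * x 3 * b2 + x 3 * x 5 * b3)); first by ring.
by rewrite dc subrr mul0r.
Qed.

Lemma normal_form_qr (A : comNzRingType) (x : 'I_10 -> A) c d b0 b1 b2 b3 :
  d * c = 1 ->
  x 5 * normal_form x b0 b1 b2 b3 =
  normal_form x (d * x 4 * x 6 * b3) (d * x 6 * b2) (x 4 * b1) b0 +
  (b1 * (x 2 * x 5 - x 4 * x 3) + d * b2 * (c * (x 3 * x 5) - x 2 * x 6)
   + d * b3 * (c * (x 5 * x 5) - x 4 * x 6)).
Proof.
rewrite /normal_form => dc; apply/eqP; rewrite -subr_eq0; apply/eqP.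
transitivity ((1 - d * c) * (x 3 * x 5 * b2 + x 5 * x 5 * b3)); first by ring.
by rewrite dc subrr mul0r.
Qed.

(** The four parity classes are told apart by the signs they acquire when one of
    p, q, r is negated. *)
Lemma sign_separation (C : numFieldType) (p q r y0 y1 y2 y3 : C) :
  (forall e1 e2 e3 : bool,
    let p' := (-1) ^+ e1 * p in let q' := (-1) ^+ e2 * q in let r' := (-1) ^+ e3 * r in
    y0 + p' * q' * y1 + p' * r' * y2 + q' * r' * y3 = 0) ->
  [/\ y0 = 0, p * q * y1 = 0, p * r * y2 = 0 & q * r * y3 = 0].
Proof.
move=> E; have four0 : 4%:R != 0 :> C by rewrite pnatr_eq0.
have := (E false false false, E true false false, E false true false, E false false true).
rewrite /= !expr0 !expr1 => -[[[E1 E2] E3] E4].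
split; apply: (mulfI four0); rewrite mulr0.
- by transitivity (0 + 0 + 0 + 0 : C); [rewrite -{1}E1 -{1}E2 -{1}E3 -E4; ring | rewrite !addr0].
- by transitivity (0 - 0 - 0 + 0 : C); [rewrite -{1}E1 -{1}E2 -{1}E3 -E4; ring | rewrite !subr0 addr0].
- by transitivity (0 - 0 + 0 - 0 : C); [rewrite -{1}E1 -{1}E2 -{1}E3 -E4; ring | rewrite !subr0 addr0].
- by transitivity (0 + 0 - 0 - 0 : C); [rewrite -{1}E1 -{1}E2 -{1}E3 -E4; ring | rewrite !subr0 addr0].
Qed.

(** * The tangent cone at a point with the given local model *)

Section TangentCone.
Variables (C : numClosedFieldType) (S : 'rV[C]_10 -> Prop).
Variables (s : 'I_10 -> 'I_10) (c : nat -> C).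
Hypothesis s_inj : injective s.
Hypothesis c0 : c 0%N != 0.
(* [s] lists the coordinates of the projective space in the order of
   [local_coords].  The next two hypotheses bound the ideal of [S] from both
   sides: its elements vanish on the local model, and it contains the nine
   equations. *)
Hypothesis S_param : forall f p q r v, proj_ideal S f -> p * q * r != 0 ->
  (forall i : 'I_10, v (s i) = (local_coords c p q r)`_i) -> f.@[v] = 0.
Hypothesis S_eqs : forall he,
  he \in local_equations (fun i => (c i)%:MP) (fun i => 'X_(s i)) ->
  proj_ideal S ('X_(s 0) * he.1 + he.2).

Let P : 'rV[C]_10 := delta_mx 0 (s 0).
(* The point (p, q, r) of the Veronese surface goes to the point with coordinates
   [cone_coords (c 0%N) 0 p q r]. *)
Let M : 'M[C]_(6, 10) :=
  \matrix_(i, j) ((if i == 5 then c 0%N else 1) *+ (invF s_inj j == i.+1 :> nat)).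

Lemma coord_onto j : exists i, j = s i.
Proof. by exists (invF s_inj j); rewrite f_invF. Qed.

Lemma veronese_coords x i : (veronese_map x *m M) 0 (s i) =
  (cone_coords (c 0%N) 0 (x 0 0) (x 0 1) (x 0 2))`_i.
Proof.
rewrite mxE; under eq_bigr do rewrite !mxE invF_f.
rewrite !big_ord_recl big_ord0.
by case: i; do 10?[case=> [|]]; move=> //= ?; rewrite ?mulr1n ?mulr0n ?mulr0 ?mulr1 ?addr0 ?add0r // mulrC.
Qed.

Lemma veronese_free : row_free M.
Proof.
apply/row_freeP.
exists (\matrix_(j, i) ((if i == 5 then (c 0%N)^-1 else 1) *+ (invF s_inj j == i.+1 :> nat))).
apply/matrixP => i i'; rewrite !mxE.
have i10 : (i.+1 < 10)%N by rewrite ltnS (leq_trans (ltn_ord i)).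
rewrite (bigD1 (s (Ordinal i10))) //= !mxE invF_f eqxx mulr1n eqSS.
rewrite big1 ?addr0 => [|j ji].
  case: (eqVneq i i') => [<-|ii']; last by rewrite (val_eqE i i') (negbTE ii') mulr0n mulr0.
  by rewrite eqxx mulr1n; case: ifP => _; rewrite ?mulfV ?mulr1.
rewrite !mxE; case: (eqVneq (invF s_inj j : nat) i.+1) => [E|_]; last by rewrite mulr0n mul0r.
case/eqP: ji; rewrite -[j](f_invF s_inj); congr s; exact: val_inj.
Qed.

Lemma vertex_notin_span : ~~ (P <= M)%MS.
Proof.
apply/submxP => -[D /matrixP/(_ 0 (s 0))]; rewrite !mxE !eqxx big1 => [/eqP|i _].
  by rewrite oner_eq0.
by rewrite mxE invF_f mulr0.
Qed.

Lemma row_eq_coord (u v : 'rV[C]_10) : (forall i, u 0 (s i) = v 0 (s i)) -> u = v.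
Proof. by move=> uv; apply/rowP => j; have [i ->] := coord_onto j. Qed.

Lemma vertexE i : P 0 (s i) = (i == 0)%:R.
Proof. by rewrite mxE eqxx (inj_eq s_inj). Qed.

Lemma veronese_surface_map x : x != 0 -> veronese_surface M (veronese_map x *m M).
Proof. by move=> x0; exists 1, x; rewrite oner_neq0 scale1r. Qed.

Lemma cone_coordsE b x g i : (b *: P + g ^+ 2 *: (veronese_map x *m M)) 0 (s i) =
  (cone_coords (c 0%N) b (g * x 0 0) (g * x 0 1) (g * x 0 2))`_i.
Proof.
rewrite mxE [X in X + _]mxE [X in _ + X]mxE vertexE veronese_coords.
by case: i; do 10?[case=> [|]] => //= ?; ring.
Qed.

Lemma vertex_neq0 : P != 0.
Proof.
by apply/eqP => /rowP/(_ (s 0)); rewrite vertexE eqxx mxE => /eqP; rewrite oner_eq0.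
Qed.

Lemma vertex_in_cone b : b != 0 -> cone_over P (veronese_surface M) (b *: P).
Proof.
move=> b0; split; first by rewrite scaler_eq0 negb_or b0 vertex_neq0.
exists b, 0, (veronese_map (delta_mx 0 0) *m M); split; last by rewrite scale0r addr0.
apply: veronese_surface_map; apply/eqP => /rowP/(_ 0).
by rewrite !mxE !eqxx => /eqP; rewrite oner_eq0.
Qed.

(** All multiples of points of the Veronese surface are in the image of its affine
    parametrization because scalars are squares.  The origin is the case [l = 0] of
    [proj_ideal_scale]. *)
Lemma cone_idealP f : proj_ideal (cone_over P (veronese_surface M)) f <->
  forall b p q r v, (forall i : 'I_10, v (s i) = (cone_coords (c 0%N) b p q r)`_i) -> f.@[v] = 0.
Proof.
split=> [If b p q r v vE|If].
  pose x : 'rV[C]_3 := \row_i [:: p; q; r]`_i.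
  pose w := b *: P + (1 ^+ 2) *: (veronese_map x *m M).
  have wE i : v i = w 0 i.
    by have [j ->] := coord_onto i; rewrite cone_coordsE !mul1r !mxE vE.
  have [w0|w0] := eqVneq w 0.
    apply: (@proj_ideal_scale _ _ _ _ 0 _ _ If (@vertex_in_cone 1 (oner_neq0 _))) => i.
    by rewrite wE w0 mxE mul0r.
  have [x0|x0] := eqVneq x 0; last first.
    apply: (@proj_ideal_scale _ _ _ _ 1 w _ If) => [|i]; last by rewrite mul1r.
    by split=> //; exists b, (1 ^+ 2), (veronese_map x *m M); split=> //; apply: veronese_surface_map.
  have wP : w = b *: P.
    apply: row_eq_coord => i; rewrite cone_coordsE x0 [RHS]mxE vertexE !mxE.
    by case: i; do 10?[case=> [|]] => //= ?; ring.
  apply: (@proj_ideal_scale _ _ _ _ 1 w _ If) => [|i]; last by rewrite mul1r.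
  rewrite wP; apply: vertex_in_cone; apply: contraNneq w0 => b0.
  by rewrite wP b0 scale0r.
have [] := @proj_ideal_scaling C 10 (cone_over P (veronese_surface M)) f.
  move=> l v l0 [v0 [b [g [q [Vq vE]]]]].
  split; first by rewrite scaler_eq0 negb_or l0.
  by exists (l * b), (l * g), q; rewrite vE scalerDr !scalerA.
move=> _; apply=> v [v0 [b [g [q [[g' [x [g'0 x0 ->]]] ->]]]]].
rewrite scalerA -[g * g']sqrtCK; by apply: If => i; apply: cone_coordsE.
Qed.

Lemma vertex_coord k : P 0 k != 0 -> k = s 0.
Proof.
by rewrite mxE eqxx /=; case: (eqVneq k (s 0)) => // _; rewrite mulr0n eqxx.
Qed.

(** An equation [f'] of [S] vanishes on the local model with parameters
    l (l + p), l (l + q), l (l + r), whose coordinates are l^2 times a curve tending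
    to the point (p, q, r) of the Veronese surface; [initial_form_limit] concludes.
    Replacing p by l + p, and so on, makes the three parameters nonzero for general
    l, even when p q r = 0. *)
Lemma tangent_cone_vanish f b p q r v :
  tangent_cone_ideal S P f ->
  (forall i : 'I_10, v (s i) = (cone_coords (c 0%N) b p q r)`_i) -> f.@[v] = 0.
Proof.
move=> [t [Gt ->]] vE; rewrite raddf_sum big_seq big1 //= => -[a g] /Gt /=.
case=> k [f' [h [/vertex_coord -> Sf' [d [hE _ glow] ->]]]]; rewrite mevalM.
rewrite comp_mpoly_meval hE; apply/eqP; rewrite mulf_eq0; apply/orP; right; apply/eqP.
pose u (x : C) := 'X + x%:P : {poly C}.
have uE := (hornerD, hornerM, hornerC, hornerX, horner_exp, horner0).
(* The coordinate along the vertex is put to 0: the chart does not see it. *)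
pose y j : {poly C} :=
  [:: 0; u p ^+ 2; u p * u q; u p * u r; u q ^+ 2; u q * u r;
      (c 0%N)%:P * u r ^+ 2 + 'X ^+ 2 * ((c 1%N)%:P * (u p * u r) ^+ 2
        + (c 2%N)%:P * (u p * u r) * (u q * u r) + (c 3%N)%:P * (u q * u r) ^+ 2)
        + 'X ^+ 4 * (c 4%N)%:P * (u p * u q * u r) ^+ 2;
      'X ^+ 2 * u p ^+ 2 * u q * u r; 'X ^+ 2 * u p * u q ^+ 2 * u r;
      'X ^+ 2 * u p ^+ 2 * u q ^+ 2]`_(invF s_inj j).
rewrite (meval_eq (v2 := fun i => (y i).[0])); last first.
  move=> j; have [i ->] := coord_onto j.
  rewrite tnth_mktuple mevalB mevalZ !mevalXU !vertexE !vE /y invF_f.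
  by case: i; do 10?[case=> [|]] => //= ?; rewrite ?uE //; field.
apply: (initial_form_limit (e := 2) (s := 'X * (u p * u q * u r))) => //.
  by rewrite !mulf_neq0 ?polyX_eq0 // /u -[_%:P]opprK -polyCN polyXsubC_eq0.
move=> l sl; rewrite /chart_at comp_mpoly_meval.
apply: (S_param (p := l * (l + p)) (q := l * (l + q)) (r := l * (l + r)) Sf').
  move: sl; rewrite !uE !mulf_eq0 !negb_or.
  by move=> /andP[-> /andP[/andP[-> ->] ->]].
move=> i; rewrite tnth_mktuple (inj_eq s_inj).
case: eqVneq => [->|i0]; first by rewrite rmorph1.
rewrite rmorphD /= mevalC mevalXU !vertexE (negbTE i0) mul0r addr0 /y invF_f.
by case: i i0; do 10?[case=> [|]] => //= ? _; rewrite ?uE; ring.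
Qed.

(** The condition on [h] and [e] says that they do not involve the coordinate along
    the vertex, so that neither the chart nor the final homogenizing substitution
    changes them. *)
Lemma tangent_cone_leading h e d : h \is d.-homog -> e \is d.+1.-homog ->
  (forall v v', (forall i, i != 0 -> v (s i) = v' (s i)) ->
     h.@[v] = h.@[v'] /\ e.@[v] = e.@[v']) ->
  proj_ideal S ('X_(s 0) * h + e) -> tangent_cone_ideal S P h.
Proof.
move=> hh he hv SF.
have [->|h0] := eqVneq h 0; first exact: ideal_span0.
apply: ideal_span_gen; exists (s 0), ('X_(s 0) * h + e), h; split=> //.
- by rewrite vertexE eqxx oner_neq0.
- have -> : chart_at P (s 0) ('X_(s 0) * h + e) = h + e.
    apply/eqP; rewrite -subr_eq0; apply/eqP/mpoly_eq0_meval => v.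
    rewrite mevalB /chart_at comp_mpoly_meval 2!mevalD mevalM mevalXU tnth_mktuple eqxx meval1 mul1r.
    have [] := hv (fun i => (tnth [tuple if j == s 0 then 1 else
       'X_j + (P 0 j / P 0 (s 0))%:MP | j < 10] i).@[v]) v.
      move=> i i0; rewrite tnth_mktuple (inj_eq s_inj) (negbTE i0) mevalD mevalXU mevalC.
      by rewrite vertexE (negbTE i0) mul0r addr0.
    by move=> -> ->; rewrite subrr.
  exists d; split=> //; rewrite ?pihomogD.
    rewrite (pihomog_homog _ hh) (pihomog_homog _ he) eqxx.
    by rewrite (gtn_eqF (ltnSn d)) addr0.
  move=> j jd; rewrite pihomogD (pihomog_homog _ hh) (pihomog_homog _ he).
  by rewrite (gtn_eqF jd) (gtn_eqF (leqW jd)) addr0.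
apply/eqP; rewrite -subr_eq0; apply/eqP/mpoly_eq0_meval => v.
rewrite mevalB comp_mpoly_meval.
have [] := hv (fun i => (tnth [tuple 'X_j - (P 0 j / P 0 (s 0)) *: 'X_(s 0) | j < 10] i).@[v]) v.
  by move=> i i0; rewrite tnth_mktuple mevalB mevalZ !mevalXU vertexE (negbTE i0) mul0r mul0r subr0.
by move=> -> _; rewrite subrr.
Qed.

Lemma tangent_cone_equation he :
  he \in local_equations (fun i => (c i)%:MP) (fun i => 'X_(s i)) ->
  tangent_cone_ideal S P he.1.
Proof.
move=> he_in; have [d [hh eh]] := local_equations_homog he_in.
apply: (tangent_cone_leading hh eh _ (S_eqs he_in)) => v v' vv'.
case/(nthP (0, 0)): he_in {hh eh} => k k9 <-.
case: k k9 => [|[|[|[|[|[|[|[|[|//]]]]]]]]] _ /=;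
  by rewrite ?(mevalD, mevalB, mevalN, mevalM, mevalC, mevalXU) ?meval0 ?vv'.
Qed.

Lemma mpoly_ind_var (Q : {mpoly C[10]} -> Prop) :
  Q 1 -> (forall a f, Q f -> Q (a *: f)) -> Q 0 -> (forall f g, Q f -> Q g -> Q (f + g)) ->
  (forall i f, Q f -> Q ('X_(s i) * f)) -> forall f, Q f.
Proof.
move=> Q1 QZ Q0 QD QX f; rewrite [f]mpolyE.
elim/big_ind: _ => // m _; apply: QZ; rewrite mpolyXE_id.
elim/big_rec: _ => // i g _ Qg; have [j ->] := coord_onto i.
elim: (m (s j)) => [|k IH]; first by rewrite mul1r.
by rewrite exprS -mulrA; apply: QX.
Qed.

(** ** Generators of the ideal of the cone *)

Let I := tangent_cone_ideal S P.
Let X (i : 'I_10) : {mpoly C[10]} := 'X_(s i).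
(* The variables of [B] stand for the vertex coordinate, p^2, q^2 and c r^2. *)
Let lift4 (B : {mpoly C[4]}) : {mpoly C[10]} := B \mPo [tuple X 0; X 1; X 4; X 6].
Let nform (B0 B1 B2 B3 : {mpoly C[4]}) :=
  normal_form X (lift4 B0) (lift4 B1) (lift4 B2) (lift4 B3).
Let normal f := exists B0 B1 B2 B3, I (f - nform B0 B1 B2 B3).

Lemma equation_in_ideal k : (k < 9)%N ->
  I (nth (0, 0) (local_equations (fun i => (c i)%:MP) X) k).1.
Proof. by move=> k9; apply/tangent_cone_equation/mem_nth. Qed.

Lemma normal_step i f B0 B1 B2 B3 A0 A1 A2 A3 j :
  I (f - nform B0 B1 B2 B3) -> I j ->
  X i * nform B0 B1 B2 B3 = nform A0 A1 A2 A3 + j ->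
  normal (X i * f).
Proof.
move=> If Ij E; exists A0, A1, A2, A3.
have -> : X i * f - nform A0 A1 A2 A3 = X i * (f - nform B0 B1 B2 B3) + j.
  rewrite mulrBr E; move: (nform A0 A1 A2 A3) => n.
  by rewrite opprD addrA subrK.
exact: ideal_spanD (ideal_spanMl _ If) Ij.
Qed.

Lemma lift4M A B : lift4 (A * B) = lift4 A * lift4 B. Proof. exact: rmorphM. Qed.
Lemma lift4D A B : lift4 (A + B) = lift4 A + lift4 B. Proof. exact: rmorphD. Qed.
Lemma lift4C a : lift4 a%:MP = a%:MP. Proof. exact: comp_mpolyC. Qed.
Lemma lift40 : lift4 0 = 0. Proof. exact: rmorph0. Qed.

Lemma lift4X i : lift4 'X_i = [:: X 0; X 1; X 4; X 6]`_i.
Proof. exact: comp_mpolyXU. Qed.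

(** The normal forms absorb the coordinates other than pq, pr, qr that survive in the
    cone; the products of pq, pr, qr with each other are reduced by the quadrics, and
    the last three coordinates lie in the ideal. *)
Lemma normalM i f : normal f -> normal (X i * f).
Proof.
move=> [B0 [B1 [B2 [B3 If]]]].
have e := @equation_in_ideal.
have ID g h : I g -> I h -> I (g + h) by exact: ideal_spanD.
have IM g h : I h -> I (g * h) by exact: ideal_spanMl.
pose d : {mpoly C[4]} := ((c 0%N)^-1)%:MP.
have dc : lift4 d * (c 0%N)%:MP = 1 by rewrite lift4C -mpolyCM mulVf.
have scal (k : 'I_4) : X i = lift4 'X_k -> normal (X i * f).
  move=> iE; apply: (normal_step (A0 := 'X_k * B0) (A1 := 'X_k * B1) (A2 := 'X_k * B2)
    (A3 := 'X_k * B3) If (@ideal_span0 _ _)).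
  by rewrite addr0 /nform normal_formZ iE !lift4M.
have zero : I (X i) -> normal (X i * f).
  move=> Ii; exists 0, 0, 0, 0; rewrite /nform lift40 /normal_form !mulr0 !addr0 subr0 mulrC.
  exact: IM.
have iX (j : 'I_10) : i = j :> nat -> X i = X j by move=> /ord_inj ->.
have : (i < 10)%N by [].
case iE : (nat_of_ord i) => [|[|[|[|[|[|[|[|[|[|//]]]]]]]]]] _.
- by apply: (scal 0); rewrite lift4X (iX 0).
- by apply: (scal 1); rewrite lift4X (iX 1).
- apply: (normal_step (A0 := 'X_1 * 'X_2 * B1) (A1 := B0) (A2 := 'X_2 * B3) (A3 := 'X_1 * B2) If);
    last by rewrite (iX 2) // /nform !lift4M !lift4X; apply: normal_form_pq.
  exact: ID _ _ (ID _ _ (IM _ _ (e 3%N isT)) (IM _ _ (e 4%N isT))) (IM _ _ (e 5%N isT)).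
- apply: (normal_step (A0 := d * 'X_1 * 'X_3 * B2) (A1 := d * 'X_3 * B3) (A2 := B0) (A3 := 'X_1 * B1) If);
    last by rewrite (iX 3) // /nform !lift4M !lift4X; apply: normal_form_pr dc.
  exact: ID _ _ (ID _ _ (IM _ _ (e 4%N isT)) (IM _ _ (e 6%N isT))) (IM _ _ (e 7%N isT)).
- by apply: (scal 2); rewrite lift4X (iX 4).
- apply: (normal_step (A0 := d * 'X_2 * 'X_3 * B3) (A1 := d * 'X_3 * B2) (A2 := 'X_2 * B1) (A3 := B0) If);
    last by rewrite (iX 5) // /nform !lift4M !lift4X; apply: normal_form_qr dc.
  exact: ID _ _ (ID _ _ (IM _ _ (e 5%N isT)) (IM _ _ (e 7%N isT))) (IM _ _ (e 8%N isT)).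
- by apply: (scal 3); rewrite lift4X (iX 6).
- by apply: zero; rewrite (iX 7) //; apply: (e 0%N).
- by apply: zero; rewrite (iX 8) //; apply: (e 1%N).
- by apply: zero; rewrite (iX 9) //; apply: (e 2%N).
Qed.

Lemma normal_all f : normal f.
Proof.
have normalC a : normal a%:MP.
  exists a%:MP, 0, 0, 0; rewrite /nform /normal_form lift4C lift40 !mulr0 !addr0 subrr.
  exact: ideal_span0.
apply: mpoly_ind_var => [|a g [A0 [A1 [A2 [A3 IA]]]]| | |].
- exact: (normalC 1).
- exists (a%:MP * A0), (a%:MP * A1), (a%:MP * A2), (a%:MP * A3).
  rewrite /nform !lift4M lift4C -normal_formZ -mul_mpolyC -mulrBr.
  exact: ideal_spanMl.
- by rewrite -mpolyC0; apply: normalC.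
- move=> f1 f2 [A0 [A1 [A2 [A3 IA]]]] [B0 [B1 [B2 [B3 IB]]]].
  exists (A0 + B0), (A1 + B1), (A2 + B2), (A3 + B3).
  rewrite /nform !lift4D -normal_formD opprD addrACA.
  exact: ideal_spanD IA IB.
- exact: normalM.
Qed.

Lemma meval_lift4 B (v : 'I_10 -> C) :
  (lift4 B).@[v] = B.@[fun i => [:: v (s 0); v (s 1); v (s 4); v (s 6)]`_i].
Proof.
rewrite /lift4 comp_mpoly_meval; apply: meval_eq => i.
by rewrite (tnth_nth 0); case: i; do 4?[case=> [|]] => //= ?; rewrite mevalXU.
Qed.

(** The four parts of the normal form vanish separately, by sign changes of p, q, r.
    Since p^2, q^2, c r^2 take arbitrary values, each part is a polynomial in
    independent variables, times a monomial. *)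
Lemma nform_eq0 B0 B1 B2 B3 :
  (forall b p q r v, (forall i : 'I_10, v (s i) = (cone_coords (c 0%N) b p q r)`_i) ->
     (nform B0 B1 B2 B3).@[v] = 0) ->
  nform B0 B1 B2 B3 = 0.
Proof.
move=> N0.
pose z (b p q r : C) (i : 'I_4) := [:: b; p ^+ 2; q ^+ 2; c 0%N * r ^+ 2]`_i.
have NE b p q r : B0.@[z b p q r] + p * q * B1.@[z b p q r] + p * r * B2.@[z b p q r]
    + q * r * B3.@[z b p q r] = 0.
  pose v j := (cone_coords (c 0%N) b p q r)`_(invF s_inj j).
  have vE i : v (s i) = (cone_coords (c 0%N) b p q r)`_i by rewrite /v invF_f.
  rewrite -[RHS](N0 b p q r v vE) /nform /normal_form !mevalD !mevalM !mevalXU !meval_lift4.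
  by rewrite !vE.
have parts b p q r : [/\ B0.@[z b p q r] = 0, p * q * B1.@[z b p q r] = 0,
    p * r * B2.@[z b p q r] = 0 & q * r * B3.@[z b p q r] = 0].
  apply: sign_separation => e1 e2 e3 p' q' r'; rewrite -[RHS](NE b p' q' r').
  have zE : z b p' q' r' =1 z b p q r by move=> i; rewrite /z /p' /q' /r' !exprMn !sqrr_sign !mul1r.
  by rewrite !(meval_eq _ zE).
have zsq (w : 'I_4 -> C) : exists b p q r, w =1 z b p q r.
  exists (w 0), (sqrtC (w 1)), (sqrtC (w 2)), (sqrtC (w 3 / c 0%N)) => i.
  rewrite /z !sqrtCK mulrC divfK //.
  by case: i; do 4?[case=> [|]] => //= ?; congr w; apply: val_inj.
have X0 (i : 'I_4) : 'X_i != 0 :> {mpoly C[4]}.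
  apply/eqP => /(congr1 (meval (fun=> 1))); rewrite mevalXU meval0 => /eqP.
  by rewrite oner_eq0.
(* Multiplied by pq, the part pq * B1 becomes p^2 q^2 * B1, a polynomial in the
   squares; similarly for the parts at pr and qr. *)
have cancel (i j : 'I_4) (B : {mpoly C[4]}) : (forall w, w i * w j * B.@[w] = 0) -> B = 0.
  move=> wB; apply/eqP; have : 'X_i * 'X_j * B == 0.
    by apply/eqP; apply: mpoly_eq0_meval => w; rewrite !mevalM !mevalXU.
  by rewrite !mulf_eq0 !(negbTE (X0 _)).
have [-> [-> [-> ->]]] : [/\ B0 = 0, B1 = 0 , B2 = 0 & B3 = 0].
  split.
  - apply: mpoly_eq0_meval => w; have [b [p [q [r wE]]]] := zsq w.
    by rewrite (meval_eq _ wE); case: (parts b p q r).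
  - apply: (@cancel 1 2) => w; have [b [p [q [r wE]]]] := zsq w.
    have [_ E _ _] := parts b p q r; rewrite (meval_eq _ wE) !wE /z /=.
    by transitivity (p * q * 0 : C); [rewrite -[in RHS]E; ring | rewrite mulr0].
  - apply: (@cancel 1 3) => w; have [b [p [q [r wE]]]] := zsq w.
    have [_ _ E _] := parts b p q r; rewrite (meval_eq _ wE) !wE /z /=.
    by transitivity (c 0%N * p * r * 0 : C); [rewrite -[in RHS]E; ring | rewrite mulr0].
  - apply: (@cancel 2 3) => w; have [b [p [q [r wE]]]] := zsq w.
    have [_ _ _ E] := parts b p q r; rewrite (meval_eq _ wE) !wE /z /=.
    by transitivity (c 0%N * q * r * 0 : C); [rewrite -[in RHS]E; ring | rewrite mulr0].
by rewrite /nform lift40 /normal_form !mulr0 !addr0.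
Qed.

(** The ideal of the tangent cone vanishes on the cone.  Conversely an equation of
    the cone equals, modulo the nine forms, a normal form vanishing on the cone, that
    is, 0. *)
Theorem tangent_cone_veronese : is_cone_over_veronese P (tangent_cone_ideal S P).
Proof.
exists M; split; [exact: veronese_free | exact: vertex_notin_span |] => f.
rewrite cone_idealP; split=> [If b p q r v vE|Zf]; first exact: tangent_cone_vanish If vE.
have [B0 [B1 [B2 [B3 IB]]]] := normal_all f.
suff N0 : nform B0 B1 B2 B3 = 0 by move: IB; rewrite N0 subr0.
apply: nform_eq0 => b p q r v vE.
have := tangent_cone_vanish IB vE.
by rewrite mevalB (Zf _ _ _ _ _ vE) sub0r => /eqP; rewrite oppr_eq0 => /eqP.
Qed.
End TangentCone.

(** * The KLM threefold *)

Definition KLM_param (C : fieldType) (a : 'I_14 -> C) (t : 'rV[C]_4) : 'rV[C]_10 :=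
  KLM_projection a (sextic_map t).

Lemma KLM_paramE (C : fieldType) (a : 'I_14 -> C) t i :
  KLM_param a t 0 i =
  let t0 := t 0 0 in let t1 := t 0 1 in let t2 := t 0 2 in let t3 := t 0 3 in
  [:: t0 * t1 ^+ 3 * t2 * t3 + a 1 * (t0 ^+ 2 * t1 ^+ 2 * t2 ^+ 2)
        + a 2 * (t0 ^+ 2 * t1 ^+ 2 * t2 * t3) + a 3 * (t0 ^+ 2 * t1 ^+ 2 * t3 ^+ 2)
        + a 4 * (t0 ^+ 3 * t1 * t2 * t3);
      t0 * t1 ^+ 2 * t2 ^+ 2 * t3; t0 * t1 ^+ 2 * t2 * t3 ^+ 2;
      t0 ^+ 2 * t1 * t2 ^+ 2 * t3; t0 ^+ 2 * t1 * t2 * t3 ^+ 2;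
      t1 ^+ 2 * t2 ^+ 2 * t3 ^+ 2; t0 * t1 * t2 ^+ 3 * t3;
      t0 * t1 * t2 ^+ 2 * t3 ^+ 2; t0 * t1 * t2 * t3 ^+ 3;
      t0 ^+ 2 * t2 ^+ 2 * t3 ^+ 2]`_i.
Proof. by rewrite mxE; case: i; do 10?[case=> [|]] => //= ?; rewrite !mxE. Qed.

Lemma KLM_param_image (C : fieldType) (a : 'I_14 -> C) t :
  KLM_param a t != 0 -> rat_image (KLM_projection a) (@W_F13 C) (KLM_param a t).
Proof.
move=> k0; split=> //; exists (sextic_map t) => //.
have proj0 : KLM_projection a 0 = 0.
  by apply/rowP => i; rewrite !mxE; case: i; do 10?[case=> [|]] => //= ?; rewrite ?mxE ?mulr0 ?addr0.
have sextic0 : sextic_map (0 : 'rV[C]_4) = 0.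
  apply/rowP => i; rewrite !mxE.
  by case: i; do 14?[case=> [|]] => //= ?; rewrite ?(expr0n, mulr0, mul0r).
have w0 : sextic_map t != 0.
  by apply: contraNneq k0 => w0; rewrite /KLM_param w0 proj0.
split=> // d f fd If; rewrite -(pihomog_dE fd); apply: If.
split=> //; exists t => //.
by apply: contraNneq w0 => ->; rewrite sextic0.
Qed.

Lemma proj_ideal_W_KLM9 (C : fieldType) (a : 'I_14 -> C) f :
  proj_ideal (W_KLM9 a) f <-> proj_ideal (rat_image (KLM_projection a) (@W_F13 C)) f.
Proof. by apply: proj_ideal_closure => v []. Qed.

(** The projection as linear forms, so that equations can be pulled back to the
    space containing [W_F13]. *)
Definition KLM_forms (C : fieldType) (a : 'I_14 -> C) : 10.-tuple {mpoly C[14]} :=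
  [tuple 'X_0 + a 1 *: 'X_1 + a 2 *: 'X_2 + a 3 *: 'X_3 + a 4 *: 'X_4;
         'X_5; 'X_6; 'X_7; 'X_8; 'X_9; 'X_10; 'X_11; 'X_12; 'X_13].

Lemma proj_ideal_W_KLM9_homog (C : fieldType) (a : 'I_14 -> C) d f :
  f \is d.-homog -> (forall t, f.@[KLM_param a t 0] = 0) -> proj_ideal (W_KLM9 a) f.
Proof.
move=> fd f0.
have compE w : f.@[KLM_projection a w 0] = (f \mPo KLM_forms a).@[w 0].
  rewrite comp_mpoly_meval; apply: meval_eq => i; rewrite mxE (tnth_nth 0).
  by case: i; do 10?[case=> [|]] => //= ?; rewrite ?mevalD ?mevalZ ?mevalXU.
have comp_d : f \mPo KLM_forms a \is d.-homog.
  apply: dhomog_comp fd _ => i; rewrite (tnth_nth 0).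
  case: i; do 10?[case=> [|]] => //= ?; rewrite ?dhomog_var //.
  by do ?apply: rpredD; rewrite ?rpredZ ?dhomog_var.
apply: (proj2 (proj_ideal_W_KLM9 a f)); apply: (proj_ideal_homog fd) => _ [_ [w [_ wF] ->]].
rewrite compE; apply: (wF d) => //; apply: (proj_ideal_homog comp_d) => _ [_ [t _ ->]].
by rewrite -compE; apply: f0.
Qed.

Lemma W_KLM9_tangent_cone (C : numClosedFieldType) (a : 'I_14 -> C) (s : 'I_10 -> 'I_10)
    (c : nat -> C) (tt : C -> C -> C -> 'rV[C]_4) :
  injective s -> c 0%N != 0 ->
  (forall p q r i, KLM_param a (tt p q r) 0 (s i) = (p * q * r) ^+ 2 * (local_coords c p q r)`_i) ->
  (forall t he, he \in local_equations c (fun i => KLM_param a t 0 (s i)) ->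
     KLM_param a t 0 (s 0) * he.1 + he.2 = 0) ->
  is_cone_over_veronese (delta_mx 0 (s 0)) (tangent_cone_ideal (W_KLM9 a) (delta_mx 0 (s 0))).
Proof.
move=> s_inj c0 param eqs; apply: (tangent_cone_veronese s_inj c0).
  move=> f p q r v /proj_ideal_W_KLM9 If pqr vE.
  have k0 : KLM_param a (tt p q r) != 0.
    apply/eqP => /rowP/(_ (s 0)); rewrite param mxE mulr1 => /eqP.
    by rewrite expf_eq0 (negbTE pqr).
  apply: (proj_ideal_scale (l := (p * q * r) ^- 2) If (KLM_param_image k0)) => j.
  by have [i ->] := coord_onto s_inj j; rewrite vE param mulKf // expf_neq0.
move=> he he_in; have [d [hh eh]] := local_equations_homog he_in.
apply: (@proj_ideal_W_KLM9_homog _ _ d.+1).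
  by apply: rpredD => //; apply: dhomogM (dhomog_var _ _) hh.
move=> t; rewrite mevalD mevalM mevalXU.
exact: eqs (local_equations_meval _ he_in).
Qed.

(** ** The four points *)

(** The coordinates of the ambient space in the order of [local_coords]; the first
    is the one that is nonzero at the point. *)
Definition point_coords (i : 'I_4) : seq 'I_10 :=
  nth [::] [:: [:: 5; 6; 7; 1; 8; 2; 0; 3; 4; 9]; [:: 9; 6; 7; 3; 8; 4; 0; 1; 2; 5];
               [:: 6; 5; 7; 1; 9; 3; 0; 2; 4; 8]; [:: 8; 5; 7; 2; 9; 4; 0; 1; 3; 6]] i.

(** The first is the coefficient in z_0 of the monomial, among w_0, w_4, w_1, w_3,
    that equals r^2 in the chart; a_0 = 1. *)
Definition point_coefs (C : fieldType) (a : 'I_14 -> C) (i : 'I_4) : seq C :=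
  nth [::] [:: [:: 1; a 1; a 2; a 3; a 4]; [:: a 4; a 1; a 2; a 3; 1];
               [:: a 1; 1; a 2; a 4; a 3]; [:: a 3; 1; a 2; a 4; a 1]] i.

(** In the charts p, q, r are square roots of Laurent monomials.  At the first point
    these are t_0 t_2 / (t_1 t_3), t_0 t_3 / (t_1 t_2) and t_0 t_1 / (t_2 t_3), with
    pq = t_0 / t_1, pr = t_0 / t_3 and qr = t_0 / t_2; at the third one
    pq = t_3 / t_2, pr = t_1 / t_2 and qr = t_0 / t_2.  Exchanging t_0 with t_1 turns
    the first point into the second, and exchanging t_2 with t_3 the third into the
    fourth. *)
Definition point_param (C : fieldType) (i : 'I_4) (p q r : C) : 'rV[C]_4 :=
  \row_j (nth [::] [:: [:: p * q * r; r; p; q]; [:: r; p * q * r; p; q];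
                       [:: q * r; p * r; 1; p * q]; [:: q * r; p * r; p * q; 1]] i)`_j.

Lemma KLM_param_chart (C : fieldType) (a : 'I_14 -> C) i p q r (j : 'I_10) :
  KLM_param a (point_param i p q r) 0 (nth 0 (point_coords i) j) =
  (p * q * r) ^+ 2 * (local_coords (nth 0 (point_coefs a i)) p q r)`_j.
Proof.
rewrite KLM_paramE /= !mxE.
by case: i => -[|[|[|[|//]]]] ?; case: j => -[|[|[|[|[|[|[|[|[|[|//]]]]]]]]]] ? /=; ring.
Qed.

Lemma KLM_param_equations (C : fieldType) (a : 'I_14 -> C) i t he :
  he \in local_equations (nth 0 (point_coefs a i))
           (fun j : 'I_10 => KLM_param a t 0 (nth 0 (point_coords i) j)) ->
  KLM_param a t 0 (nth 0 (point_coords i) 0) * he.1 + he.2 = 0.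
Proof.
move=> /(nthP (0, 0)) [k k9 <-]; have {}k9 : (k < 9)%N := k9.
rewrite /local_equations !KLM_paramE.
move: (t 0 0) (t 0 1) (t 0 2) (t 0 3) => t0 t1 t2 t3.
case: i => -[|[|[|[|//]]]] ?; case: k k9 => [|[|[|[|[|[|[|[|[|//]]]]]]]]] _ /=; ring.
Qed.

Theorem proposition10p2 (R : realType) (a : 'I_14 -> R[i])
  (ha0 : a 0 = 1)
  (ha : forall k : 'I_14, k \in [:: 1; 3; 4; 9; 10; 12; 13] -> a k != 0)
  (i : 'I_4) :
  is_cone_over_veronese (P_KLM R[i] i)
    (tangent_cone_ideal (W_KLM9 a) (P_KLM R[i] i)).
Proof.
have -> : P_KLM R[i] i = delta_mx 0 (nth 0 (point_coords i) 0).
  by congr delta_mx; rewrite (tnth_nth 0); case: i => -[|[|[|[|//]]]] ?.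
apply: (W_KLM9_tangent_cone (s := fun j : 'I_10 => nth 0 (point_coords i) j) (tt := point_param i)
  (c := nth 0 (point_coefs a i))).
- have [s10 s_uniq] : size (point_coords i) = 10%N /\ uniq (point_coords i).
    by case: i => -[|[|[|[|//]]]] ?.
  by move=> j k /eqP; rewrite nth_uniq ?s10 // => /eqP/val_inj.
- by case: i => -[|[|[|[|//]]]] ? /=; rewrite ?oner_neq0 ?ha.
- exact: KLM_param_chart.
- exact: KLM_param_equations.
Qed.
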